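(* Let $B$ be a Banach algebra and let $(a_n)_{n\in\mathbb N}\subset B$ and $(d_n)_{n\in\mathbb N}\subset B$ be two sequences converging to $a$ and $d$, respectively. Suppose that $a$ is invertible along $d$ and that $a_n$ is invertible along $d_n$ for each $n\in\mathbb N$. Let $d_n^-$ be an inner inverse of $d_n$ for each $n\in\mathbb N$. Then: (i) If $a_n^{\parallel d_n}$ converges to $a^{\parallel d}$, then $(a_n^{\parallel d_n})_{n}$ is a bounded sequence. (ii) If $(a_n^{\parallel d_n})_{n}$ is a bounded sequence and $\sup_n \| d_n^- \|<\infty$, then $a_n^{\parallel d_n}\to a^{\parallel d}$.
   Context: Banach algebras are complex and have a unit $1$; convergence is in norm. An inner inverse of $x\in B$ is an element $x^-\in B$ with $x=xx^-x$. For $a,d\in B$, $a$ is invertible along $d$ if there exists $b\in B$ such that $bab=b$, $bB=dB$ and $Bb=Bd$. Such $b$ is unique when it exists and is denoted $a^{\parallel d}$. It is known that if $a$ is invertible along $d$ then $d$ has an inner inverse. *)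

(* Defs.v *)
From HB Require Import structures.
From mathcomp Require Import all_boot all_order all_algebra.
From mathcomp Require Import all_classical all_reals all_analysis.
From mathcomp Require Export complex.

Set Implicit Arguments.
Unset Strict Implicit.
Unset Printing Implicit Defensive.

Import Order.TTheory GRing.Theory Num.Theory.
Import numFieldNormedType.Exports.

Local Open Scope classical_set_scope.
Local Open Scope ring_scope.

(* A unital Banach algebra over K; the complex case is K = R[i].  The product
   is a field of the mixin because HB cannot join GRing.PzSemiRing with
   Num.SemiNormedZmodule once Num.NumDomain inherits from both; the ring
   structure is recovered by the instance below.  Neither `|1| = 1 nor 1 != 0
   is imposed, hence pzRingType instead of algType. *)
HB.mixin Record CompleteNormedModule_isBanachAlgebra (K : numFieldType) B
    & CompleteNormedModule K B := {
  banach_one : B ;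
  banach_mul : B -> B -> B ;
  banach_mulA : associative banach_mul ;
  banach_mul1l : left_id banach_one banach_mul ;
  banach_mul1r : right_id banach_one banach_mul ;
  banach_mulDl : left_distributive banach_mul +%R ;
  banach_mulDr : right_distributive banach_mul +%R ;
  banach_scaleAl : forall (k : K) (x y : B),
    k *: banach_mul x y = banach_mul (k *: x) y ;
  banach_scaleAr : forall (k : K) (x y : B),
    k *: banach_mul x y = banach_mul x (k *: y) ;
  banach_normM : forall x y : B, `|banach_mul x y| <= `|x| * `|y|
}.

#[short(type="banachAlgType")]
HB.structure Definition BanachAlgebra (K : numFieldType) :=
  {B of CompleteNormedModule K B & CompleteNormedModule_isBanachAlgebra K B}.

HB.instance Definition _ (K : numFieldType) (B : banachAlgType K) :=
  GRing.Zmodule_isPzRing.Build (BanachAlgebra.sort B)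
    (@banach_mulA K B) (@banach_mul1l K B) (@banach_mul1r K B)
    (@banach_mulDl K B) (@banach_mulDr K B).

Section BanachAlgebraTheory.
Context {K : numFieldType} {B : banachAlgType K}.
Implicit Types x y : B.

Lemma banach_scalerAl (k : K) x y : k *: (x * y) = (k *: x) * y.
Proof. exact: banach_scaleAl. Qed.

Lemma banach_scalerAr (k : K) x y : k *: (x * y) = x * (k *: y).
Proof. exact: banach_scaleAr. Qed.

Lemma banach_normrM x y : `|x * y| <= `|x| * `|y|.
Proof. exact: banach_normM. Qed.

End BanachAlgebraTheory.

Section InverseAlong.
Context {B : pzRingType}.
Implicit Types a d b x y : B.

Definition inner_inverse x y : Prop := x = x * y * x.

Definition is_inverse_along a d b : Prop :=
  [/\ b * a * b = b,
      [set b * x | x in [set: B]] = [set d * x | x in [set: B]]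
    & [set x * b | x in [set: B]] = [set x * d | x in [set: B]]].

Definition invertible_along a d : Prop := exists b, is_inverse_along a d b.

(* Junk value 0 when a is not invertible along d. *)
Definition inverse_along a d : B := xget 0 [set b | is_inverse_along a d b].

Lemma is_inverse_along_unique a d b1 b2 :
  is_inverse_along a d b1 -> is_inverse_along a d b2 -> b1 = b2.
Proof.
move=> [b1E b1B Bb1] [b2E b2B Bb2].
have [x b1x] : [set b2 * x | x in [set: B]] b1.
  by rewrite b2B -b1B; exists 1 => //; rewrite mulr1.
have [y b2y] : [set x * b1 | x in [set: B]] b2.
  by rewrite Bb1 -Bb2; exists 1 => //; rewrite mul1r.
move=> b2y1 b1x1.
have <- : b2 * a * b1 = b1 by rewrite -b1x1 mulrA b2E.
by rewrite -{1}b2y1 -!mulrA (mulrA b1) b1E.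
Qed.

Lemma inverse_alongP a d :
  invertible_along a d -> is_inverse_along a d (inverse_along a d).
Proof. by move=> [b bP]; rewrite /inverse_along; case: xgetP => // /(_ b). Qed.

Lemma inverse_alongE a d b :
  is_inverse_along a d b -> inverse_along a d = b.
Proof.
move=> bP; apply: is_inverse_along_unique (bP).
by apply: inverse_alongP; exists b.
Qed.

End InverseAlong.

(* Main.v *)
(** With [b = a^{∥d} = d x], [b_n = a_n^{∥d_n}] and [d_n^-] an inner inverse of [d_n],
    [b_n - b = b_n (1 - a b) - (1 - b_n a) b].  As [d a b = d] and
    [b_n a_n d_n = d_n], both terms can be rewritten with the factors [d_n - d]
    and [a_n - a]:
      [b_n (1 - a b) = b_n d_n^- (d_n - d) (1 - a b)],
      [(1 - b_n a) d = b_n (a_n - a) d - (1 - b_n a_n) (d_n - d)],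
    and all the other factors are bounded. *)
Require Import Defs.
From mathcomp Require Import all_boot all_order all_algebra.
From mathcomp Require Import all_classical all_reals all_analysis.
From mathcomp Require Import complex.

Set Implicit Arguments.
Unset Strict Implicit.
Unset Printing Implicit Defensive.

Import Order.TTheory GRing.Theory Num.Theory.
Import numFieldNormedType.Exports.

Local Open Scope classical_set_scope.
Local Open Scope ring_scope.

Section InverseAlong.
Context {B : pzRingType}.
Implicit Types a d b e x : B.

Lemma is_inverse_along_factorl a d b :
  is_inverse_along a d b -> exists x, b = d * x.
Proof.
move=> [_ bB _].
have [x _ <-] : [set d * x | x in [set: B]] b.
  by rewrite -bB; exists 1 => //; rewrite mulr1.
by exists x.
Qed.

(** Left multiplication by [b * a] is the identity on [b B], and [d] lies there because
    [b B = d B]. *)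
Lemma is_inverse_along_mulVl a d b : is_inverse_along a d b -> b * a * d = d.
Proof.
move=> [bab bB _].
have [x _ <-] : [set b * x | x in [set: B]] d.
  by rewrite bB; exists 1 => //; rewrite mulr1.
by rewrite mulrA bab.
Qed.

Lemma is_inverse_along_mulVr a d b : is_inverse_along a d b -> d * a * b = d.
Proof.
move=> [bab _ Bb].
have [x _ <-] : [set x * b | x in [set: B]] d.
  by rewrite Bb; exists 1 => //; rewrite mul1r.
by rewrite -!mulrA (mulrA b) bab.
Qed.

(** Right multiplication by the idempotent [e * d] is the identity on [B d], which contains [b]. *)
Lemma is_inverse_along_inner a d b e :
  is_inverse_along a d b -> inner_inverse d e -> b * e * d = b.
Proof.
move=> [_ _ Bb] ded.
have [x _ <-] : [set x * d | x in [set: B]] b.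
  by rewrite -Bb; exists 1 => //; rewrite mul1r.
by rewrite -!mulrA (mulrA d) -ded.
Qed.

(** Every summand on the right contains [d' - d] or [a' - a]. Writing [b] as [d * x] lets
    [(1 - b' * a) * b] inherit such a factor from [(1 - b' * a) * d]. *)
Lemma is_inverse_along_sub a d b x a' d' b' e' :
    is_inverse_along a d b -> b = d * x ->
    is_inverse_along a' d' b' -> inner_inverse d' e' ->
  b' - b = b' * e' * ((d' - d) * (1 - a * b)) + (d' - d) * x
           - (b' * a' * ((d' - d) * x) + b' * ((a' - a) * b)).
Proof.
move=> abd bE abd' ded'.
have -> : b' * e' * ((d' - d) * (1 - a * b)) = b' - b' * a * b.
  (* Since [d * a * b = d], the element [d] annihilates [1 - a * b]. *)
  have -> : (d' - d) * (1 - a * b) = d' * (1 - a * b).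
    rewrite mulrBl [d * _]mulrBr mulr1 mulrA (is_inverse_along_mulVr abd).
    by rewrite subrr subr0.
  by rewrite mulrA (is_inverse_along_inner abd') // mulrBr mulr1 mulrA.
have -> : (d' - d) * x = d' * x - b by rewrite mulrBl -bE.
(* As [b' * a'] fixes [d'], the term [d' * x] appears in both halves and cancels. *)
have -> : b' * a' * (d' * x - b) = d' * x - b' * a' * b.
  by rewrite mulrBr mulrA (is_inverse_along_mulVl abd').
rewrite [(a' - a) * b]mulrBl [b' * (_ - _)]mulrBr !mulrA subrKA.
by rewrite opprB addrAC !subrKA.
Qed.

End InverseAlong.

Section BoundedNear.
Context {K : numFieldType} {V : normedModType K} {T : Type}.
Context {F : set_system T} {FF : ProperFilter F}.

Lemma bounded_near_cst (c : V) : bounded_near (fun=> c) F.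
Proof. by apply/ex_bound; exists `|c|; apply: nearW => t /=. Qed.

Lemma bounded_fun_near (f : T -> V) : bounded_fun f -> bounded_near f F.
Proof. by apply: filterS => M fM; apply: nearW => t; apply: fM. Qed.

End BoundedNear.

Section BoundedMul.
Context {K : numFieldType} {B : banachAlgType K} {T : Type}.
Context {F : set_system T} {FF : ProperFilter F}.
Implicit Types u v : T -> B.

Lemma bounded_near_mul u v :
  bounded_near u F -> bounded_near v F -> bounded_near (fun t => u t * v t) F.
Proof.
move=> /ex_bound[M uM] /ex_bound[N vN]; apply/ex_bound; exists (M * N).
near=> t; apply: le_trans (banach_normrM _ _) _.
by apply: ler_pM => //; near: t.
Unshelve. all: by end_near. Qed.

Lemma bounded_near_mul_cvg0 u v :
  bounded_near u F -> v t @[t --> F] --> 0 -> (u t * v t) @[t --> F] --> 0.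
Proof.
move=> /ex_strict_bound_gt0[M M0 uM] /cvgr0Pnorm_lt v0.
apply/cvgr0Pnorm_lt => e e0; near=> t.
apply: le_lt_trans (banach_normrM _ _) _.
(* With [M] a strict bound on [u], split [e] as [M * (e / M)] and make [v] smaller than [e / M]. *)
rewrite -(divfK (lt0r_neq0 M0) e) mulrC.
apply: ltr_pM => //; last by near: t.
by near: t; apply: v0; rewrite divr_gt0.
Unshelve. all: by end_near. Qed.

Lemma cvg0_mul_bounded_near u v :
  u t @[t --> F] --> 0 -> bounded_near v F -> (u t * v t) @[t --> F] --> 0.
Proof.
move=> /cvgr0Pnorm_lt u0 /ex_strict_bound_gt0[M M0 vM].
apply/cvgr0Pnorm_lt => e e0; near=> t.
apply: le_lt_trans (banach_normrM _ _) _.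
rewrite -(divfK (lt0r_neq0 M0) e).
apply: ltr_pM => //; last by near: t.
by near: t; apply: u0; rewrite divr_gt0.
Unshelve. all: by end_near. Qed.

End BoundedMul.

(** The norm takes values in [R[i]] but is real, so its real part determines it and the supremum,
    once finite, embeds back as a bound. *)
Lemma bounded_near_ereal_sup (R : realType) (V : normedModType R[i])
    (T : Type) (F : set_system T) {FF : ProperFilter F} (f : T -> V) :
  (ereal_sup (range (fun t => (complex.Re `|f t|)%:E)) < +oo)%E ->
  bounded_near f F.
Proof.
set S := range _ => Soo; apply/ex_bound.
exists (fine (ereal_sup S))%:C%C; apply: nearW => t /=.
have St : ((complex.Re `|f t|)%:E <= ereal_sup S)%E.
  by apply: ereal_sup_ubound; exists t.
rewrite -(RRe_real (normr_real (f t))) lecR -lee_fin fineK//.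
(* The supremum is not [-oo], being at least the real number at [t]. *)
by rewrite fin_numE (lt_eqF Soo) andbT -ltNye (lt_le_trans _ St) ?ltNyr.
Qed.

Theorem theorem6p2 (R : realType) (B : banachAlgType R[i])
    (a_ d_ : nat -> B) (a d : B) (dm : nat -> B) :
  a_ n @[n --> \oo] --> a ->
  d_ n @[n --> \oo] --> d ->
  invertible_along a d ->
  (forall n, invertible_along (a_ n) (d_ n)) ->
  (forall n, inner_inverse (d_ n) (dm n)) ->
  (inverse_along (a_ n) (d_ n) @[n --> \oo] --> inverse_along a d ->
   bounded_fun (fun n => inverse_along (a_ n) (d_ n)))
  /\
  (bounded_fun (fun n => inverse_along (a_ n) (d_ n)) ->
   (ereal_sup (range (fun n => (complex.Re `|dm n|)%:E)) < +oo)%E ->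
   inverse_along (a_ n) (d_ n) @[n --> \oo] --> inverse_along a d).
Proof.
move=> aa dd abd abd_ ded_; split=> [cb|bb sup_dm].
  by apply: cvg_seq_bounded; apply/cvg_ex; eexists; exact: cb.
(* Invertibility rules out the default value 0 of [inverse_along]. *)
have {}abd := inverse_alongP abd.
have {}abd_ n := inverse_alongP (abd_ n).
move: bb abd abd_; set b := inverse_along a d.
set b_ := fun n => inverse_along (a_ n) (d_ n) => bb abd abd_.
(* The factor [x] comes from the limit pair, so it does not depend on [n]. *)
have [x bE] := is_inverse_along_factorl abd.
have x_bounded : bounded_near (fun=> x) \oo by exact: bounded_near_cst.
have c_bounded : bounded_near (fun=> 1 - a * b) \oo by exact: bounded_near_cst.
have b_bounded : bounded_near (fun=> b) \oo by exact: bounded_near_cst.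
have bn_bounded : bounded_near b_ \oo by exact: bounded_fun_near.
have a_bounded : bounded_near a_ \oo by exact: cvg_bounded aa.
have dm_bounded : bounded_near dm \oo by exact: bounded_near_ereal_sup sup_dm.
move/subr_cvg0 : dd => dd0; move/subr_cvg0 : aa => aa0.
apply/subr_cvg0.
under eq_cvg do rewrite (is_inverse_along_sub abd bE (abd_ _) (ded_ _)).
have dx0 : ((d_ n - d) * x) @[n --> \oo] --> 0.
  exact: cvg0_mul_bounded_near.
(* The limit is put in the shape of the four summands, each a null factor times bounded ones. *)
rewrite (_ : 0 = 0 + 0 - (0 + 0) :> B); last by rewrite !addr0 subr0.
apply: cvgB; apply: cvgD => //; apply: bounded_near_mul_cvg0 => //.
- exact: bounded_near_mul.
- exact: cvg0_mul_bounded_near.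
- exact: bounded_near_mul.
- exact: cvg0_mul_bounded_near.
Qed.
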